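(* There is an algorithm which, on every input consisting of integers $0\le m_1\le\dots\le m_k$ and a sequence $T_1,\dots,T_n\in\{H,L\}$ with $0\le H<L$ and $n=\sum_r m_r$, outputs exactly the same decision sequence as Algorithm 1, using $O(n\cdot k^2)$ time and $O(k^2)$ working space (beyond the input and output), in the unit-cost RAM model.
   Context: Algorithm 1 (simulation-based threshold algorithm). Input: integers $0\le m_1\le\dots\le m_k$ and a sequence $T_1,\dots,T_n$ with $n=\sum_r m_r$. Set $q^{(1)}_r=m_r$ for all $r$. For $t=1,\dots,n$: set $x_t=\mathrm{TA}(q^{(t)}_1,\dots,q^{(t)}_k;\,T_t,T_{t+1},\dots,T_n)$ and $q^{(t+1)}_r=q^{(t)}_r-\mathbf{1}(x_t=r)$ for each $r$. Output $\mathbf{x}=(x_1,\dots,x_n)$. Subroutine $\mathrm{TA}(m_1,\dots,m_k;\,S_1,\dots,S_N)$ (ThresholdAllocation), with the convention $m_0:=0$: for $\gamma=k,k-1,\dots,1$: if $m_\gamma=m_{\gamma-1}$, go to the next $\gamma$; otherwise, for $h=\gamma,\gamma+1,\dots,k$: let $Z_L=\sum_{i=1}^{h-1}\min\{m_i,m_{\gamma-1}\}$ and $Z_H=\sum_{i=\gamma}^{h}(m_i-m_{\gamma-1})$; if $|\{i\in\{1,\dots,Z_L+Z_H\}: S_i>S_1\}|\ge Z_L$, return $\gamma$ (agent to which $S_1$ is assigned). *)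

(* Defs.v *)
From mathcomp Require Import all_boot.
Set Implicit Arguments. Unset Strict Implicit. Unset Printing Implicit Defensive.

Inductive HL : Type := H | L.

Definition gtHL (a b : HL) : bool :=
  match a, b with L, H => true | _, _ => false end.

(* 1-indexed access with the convention m_0 := 0 *)
Definition mi (m : seq nat) (i : nat) : nat :=
  if i is j.+1 then nth 0 m j else 0.

Definition ZL (m : seq nat) (g h : nat) : nat :=
  sumn [seq minn (mi m i) (mi m g.-1) | i <- index_iota 1 h].
Definition ZH (m : seq nat) (g h : nat) : nat :=
  sumn [seq mi m i - mi m g.-1 | i <- index_iota g h.+1].

Definition TA_cond (m : seq nat) (S : seq HL) (g h : nat) : bool :=
  ZL m g h <= count (fun s => gtHL s (head H S)) (take (ZL m g h + ZH m g h) S).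

(* ThresholdAllocation: scan gamma = k, k-1, ..., 1; skip if m_gamma = m_(gamma-1);
   otherwise return gamma as soon as some h in {gamma..k} satisfies the test.
   (Returns 0 if no gamma is returned, which does not happen on valid inputs.) *)
Definition TA (m : seq nat) (S : seq HL) : nat :=
  let k := size m in
  head 0 [seq g <- rev (iota 1 k) |
           (mi m g != mi m g.-1) && has (TA_cond m S g) (iota g (k.+1 - g))].

Definition decr (q : seq nat) (x : nat) : seq nat :=
  [seq (if r.+1 == x then nth 0 q r - 1 else nth 0 q r) | r <- iota 0 (size q)].

Fixpoint alg1_aux (q : seq nat) (T : seq HL) : seq nat :=
  match T with
  | [::] => [::]
  | _ :: T' => let x := TA q T in x :: alg1_aux (decr q x) T'
  end.

Definition algorithm1 (m : seq nat) (T : seq HL) : seq nat := alg1_aux m T.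

(* Registers R[0], R[1], ... hold natural numbers; read-only input     *)
(* tape (random access), write-only output tape.  Every instruction    *)
(* costs one time unit.  Working space = 1 + largest index of a        *)
(* register accessed.  Word size: we also record the largest value     *)
(* ever stored, so that it can be required to be polynomial in the     *)
(* input size (O(log n)-bit words).                                    *)

Inductive instr : Type :=
| IConst of nat & nat
| IAdd of nat & nat & nat
| ISub of nat & nat & nat    (* ISub d a b   : R[d] := R[a] - R[b] (trunc.)  *)
| ILoad of nat & nat
| IStore of nat & nat
| IIn of nat & nat           (* IIn d a      : R[d] := input[R[a]] (0 if OOB)*)
| IOut of nat
| IJz of nat & nat
| IJmp of nat
| IHalt.

Definition program := seq instr.

Record state : Type := State {
  pc : nat;
  regs : nat -> nat;
  out : seq nat;
  space : nat;
  maxval : nat;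
}.

Definition init_state : state := State 0 (fun _ => 0) [::] 0 0.

Definition upd (f : nat -> nat) (d v : nat) : nat -> nat :=
  fun i => if i == d then v else f i.

Definition halted (P : program) (st : state) : bool :=
  match nth IHalt P (pc st) with IHalt => true | _ => false end.

Definition wr (st : state) (acc : seq nat) (d v : nat) : state :=
  State (pc st).+1 (upd (regs st) d v) (out st)
        (foldr maxn (space st) [seq i.+1 | i <- acc])
        (maxn (maxval st) v).

Definition step (P : program) (inp : seq nat) (st : state) : state :=
  let R := regs st in
  match nth IHalt P (pc st) with
  | IConst d c => wr st [:: d] d c
  | IAdd d a b => wr st [:: d; a; b] d (R a + R b)
  | ISub d a b => wr st [:: d; a; b] d (R a - R b)
  | ILoad d a => wr st [:: d; a; R a] d (R (R a))
  | IStore a s => wr st [:: a; s; R a] (R a) (R s)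
  | IIn d a => wr st [:: d; a] d (nth 0 inp (R a))
  | IOut s => State (pc st).+1 R (rcons (out st) (R s))
                    (maxn (space st) s.+1) (maxval st)
  | IJz s l => State (if R s == 0 then l else (pc st).+1) R (out st)
                     (maxn (space st) s.+1) (maxval st)
  | IJmp l => State l R (out st) (space st) (maxval st)
  | IHalt => st
  end.

(* state after t steps (halted states are fixed points of step) *)
Definition run (P : program) (inp : seq nat) (t : nat) : state :=
  iter t (step P inp) init_state.

Definition code (a : HL) : nat := if a is L then 1 else 0.
Definition encode_input (m : seq nat) (T : seq HL) : seq nat :=
  [:: size m, size T & m ++ map code T].

(* Main.v *)
(* The test of ThresholdAllocation for (gamma, h) at time t looks at the window
   of the input that starts at t and ends at
     target t q gamma h = t + (q_1 + ... + q_h) - q_(gamma-1).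
   When agent x is served, the first sum drops by [x <= h] and q_(gamma-1) by
   [x = gamma-1], so the end of the window moves forward by 0 or 1 from one
   round to the next.  For each of the at most k^2 pairs it thus suffices to
   store the last end and the number of Ls before it: a round costs O(k^2),
   except the first, where every end travels from 0 and the cost is O(n k^2).
   The number of Ls in a window is the stored number minus the number of Ls
   before t.
   The RAM program is compiled from a small language with loops, for which a
   total-correctness logic bounds time, space and word size. *)

Require Import Defs.
From mathcomp Require Import all_boot zify ring.
Set Implicit Arguments. Unset Strict Implicit. Unset Printing Implicit Defensive.

(** * The windows of ThresholdAllocation *)

Definition psum (q : seq nat) (h : nat) : nat := sumn (take h q).

Definition mono (q : seq nat) : Prop :=
  forall i j, i <= j <= size q -> mi q i <= mi q j.

Lemma sorted_mono (q : seq nat) : sorted leq q -> mono q.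
Proof.
move=> q_sorted [|i] [|j] //= /andP[le_ij lt_jq].
by apply: (sorted_leq_nth leq_trans leqnn) => //; rewrite inE; lia.
Qed.

Lemma psumS (q : seq nat) (h : nat) : psum q h.+1 = psum q h + mi q h.+1.
Proof.
rewrite /psum /mi; have [lt_hq|le_qh] := ltnP h (size q).
  by rewrite (take_nth 0) // -cats1 sumn_cat /= addn0.
by rewrite !take_oversize ?nth_default ?addn0 // ltnW.
Qed.

Lemma psum_le (q : seq nat) (i j : nat) : i <= j -> psum q i <= psum q j.
Proof.
elim: j => [|j IHj]; rewrite leq_eqVlt => /orP[/eqP-> //|] //.
by rewrite ltnS psumS => /IHj; lia.
Qed.

Lemma mi_le_psum (q : seq nat) (i h : nat) : i <= h -> mi q i <= psum q h.
Proof. by case: i => // i /(psum_le q); rewrite psumS; lia. Qed.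

Lemma ZLS (q : seq nat) (g h : nat) : mono q -> 0 < g <= h -> h <= size q ->
  ZL q g h.+1 = ZL q g h + mi q g.-1.
Proof.
move=> q_mono g_h h_q; rewrite /ZL !sumnE !big_map big_nat_recr; last by lia.
by have := q_mono g.-1 h; rewrite /=; lia.
Qed.

Lemma ZL_diag (q : seq nat) (g : nat) : mono q -> 0 < g <= (size q).+1 ->
  ZL q g g = psum q g.-1.
Proof.
move=> q_mono g_q; rewrite /ZL sumnE big_map.
rewrite (eq_big_nat _ _ (F2 := mi q)) => [|i lt_ig].
  case: g g_q => // g _ /=; elim: g => [|g IHg].
    by rewrite big_geq // /psum take0.
  by rewrite big_nat_recr //= IHg psumS.
by have := q_mono i g.-1; lia.
Qed.

(** Going from [h] to [h.+1], [ZL] gains [mi q g.-1] and [ZH] gains [mi q h.+1 - mi q g.-1]: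
    together, the new summand of [psum]. The window length is thus a prefix sum minus one quota. *)
Lemma window_size (q : seq nat) (g h : nat) : mono q -> 0 < g <= h ->
  h <= size q -> ZL q g h + ZH q g h + mi q g.-1 = psum q h.
Proof.
move=> q_mono /andP[g_gt0 le_gh]; rewrite -(subnKC le_gh).
elim: (h - g) => [|d IHd] gh_q.
  rewrite addn0 ZL_diag //; last by lia.
  rewrite /ZH /index_iota subSnn /= addn0.
  rewrite -[in RHS](prednK g_gt0) psumS prednK //.
  by have := q_mono g.-1 g; lia.
rewrite addnS psumS -IHd; last by lia.
rewrite ZLS //; try lia.
rewrite /ZH !sumnE !big_map.
rewrite [in LHS]big_nat_recr; last by lia.
by have := q_mono g.-1 (g + d).+1; move=> /=; lia.
Qed.

(** * Serving an agent: effect on quotas, prefix sums and window ends *)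

Section Decr.

Variables (q : seq nat) (x : nat).
Hypotheses (q_mono : mono q) (x_range : 0 < x <= size q).
Hypothesis x_step : mi q x.-1 < mi q x.

Lemma size_decr : size (decr q x) = size q.
Proof. by rewrite size_map size_iota. Qed.

Lemma mi_decr (i : nat) : mi (decr q x) i = mi q i - (i == x).
Proof.
case: i => //= i; rewrite /decr.
have [lt_iq|le_qi] := ltnP i (size q).
  by rewrite (nth_map 0) ?size_iota // nth_iota //=; case: eqP; rewrite /= ?subn0.
by rewrite !nth_default ?size_map ?size_iota.
Qed.

(** Only the quota of [x] drops, and by [x_step] it was strictly above its predecessor. *)
Lemma mono_decr : mono (decr q x).
Proof.
move=> i j; rewrite size_decr !mi_decr => ij_q.
move: (ij_q) (q_mono ij_q) (@q_mono i x.-1); have := x_step.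
have [->|] := eqVneq j x; have [->|] := eqVneq i x; lia.
Qed.

Lemma psum_decr (h : nat) : psum (decr q x) h = psum q h - (x <= h).
Proof.
elim: h => [|h IHh]; first by rewrite /psum !take0.
rewrite !psumS IHh mi_decr.
have [eq_hx|] := eqVneq h.+1 x; first by move: x_step; rewrite -eq_hx; lia.
by have := @mi_le_psum q x h; have := x_step; lia.
Qed.

Lemma sumn_decr : sumn (decr q x) = (sumn q).-1.
Proof.
have := psum_decr (size q); rewrite /psum !take_oversize ?size_decr //.
by case/andP: x_range => _ ->; rewrite subn1.
Qed.

End Decr.

(* Relative to the whole sequence, the window of [TA_cond] for [(g, h)] at time
   [t] is [t, target t q g h). *)
Definition target (t : nat) (q : seq nat) (g h : nat) : nat :=
  t + psum q h - mi q g.-1.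

(** The change is 1 - [x <= h] + [x = g-1]. As x = g-1 forces x <= h, it is never 2. [mi_le_psum]
    keeps the truncated subtractions exact. *)
Lemma target_decr (t : nat) (q : seq nat) (x g h : nat) :
  0 < x <= size q -> mi q x.-1 < mi q x -> 0 < g <= h ->
  target t q g h <= target t.+1 (decr q x) g h <= (target t q g h).+1.
Proof.
move=> x_range x_step g_h; rewrite /target psum_decr // mi_decr.
have := @mi_le_psum q g.-1 h; have := @mi_le_psum q x h.
by have [eq_gx|] := eqVneq g.-1 x; rewrite ?eq_gx; lia.
Qed.

(** * The threshold test through prefix counts, and the agent it selects *)

Definition countL (T : seq HL) (p : nat) : nat := sumn (take p (map code T)).

Lemma countLS (T : seq HL) (p : nat) :
  countL T p.+1 = countL T p + nth 0 (map code T) p.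
Proof. exact: psumS. Qed.

(** Nothing exceeds [L], and only [L] exceeds [H]. So the count is 0 if the window starts with [L],
    and otherwise its number of Ls, a difference of two prefix counts. *)
Lemma TA_condE (q : seq nat) (T : seq HL) (t g h : nat) :
  mono q -> 0 < g <= h -> h <= size q -> t < size T ->
  TA_cond q (drop t T) g h =
  (ZL q g h <= if nth 0 (map code T) t == 0
               then countL T (target t q g h) - countL T t else 0).
Proof.
move=> q_mono g_h h_q lt_tT; rewrite /TA_cond (drop_nth H) //= (nth_map H) //.
rewrite -drop_nth //; congr (_ <= _); case: (nth H T t) => /=; last first.
  by rewrite (eq_count (a2 := pred0)) ?count_pred0 //; case.
rewrite /target -(window_size q_mono g_h h_q) addnA addnK /countL [in RHS]takeD sumn_cat.
rewrite addKn -map_drop -map_take.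
by elim: (take _ _) => //= -[] s ->.
Qed.

Definition admissible (q : seq nat) (S : seq HL) (g : nat) : bool :=
  (mi q g != mi q g.-1) && has (TA_cond q S g) (iota g ((size q).+1 - g)).

(** The head of a reversed list is the last entry of the list, so an ascending scan that overwrites
    its answer finds the same agent as the descending one. *)
Lemma TA_last (q : seq nat) (S : seq HL) :
  TA q S = last 0 [seq g <- iota 1 (size q) | admissible q S g].
Proof.
by rewrite /TA filter_rev; case: (lastP (filter _ _)) => // s x; rewrite rev_rcons last_rcons.
Qed.

(** The least [g] with a positive quota is admissible: all earlier quotas vanish, so at [h = g] the
    threshold [ZL] is 0. Any admissible quota differs from its predecessor, hence exceeds it by
    monotonicity. *)
Lemma TA_valid (q : seq nat) (S : seq HL) : mono q -> 0 < sumn q ->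
  0 < TA q S <= size q /\ mi q (TA q S).-1 < mi q (TA q S).
Proof.
move=> q_mono q_gt0.
have: has (admissible q S) (iota 1 (size q)).
  have ex_pos : exists g, 0 < mi q g.
    have: psum q (size q) > 0 by rewrite /psum take_size.
    elim: (size q) => [|h IHh]; first by rewrite /psum take0.
    rewrite psumS; have [->|h0] := posnP (mi q h.+1); first by rewrite addn0.
    by move=> _; exists h.+1.
  case: (ex_minnP ex_pos) => -[//|g] g_pos g_min.
  have lt_gq : g < size q.
    by rewrite ltnNge; apply/negP => le_qg; move: g_pos; rewrite /= nth_default.
  have g0 : mi q g = 0.
    by apply/eqP; rewrite -leqn0 leqNgt; apply/negP => /g_min; rewrite ltnn.
  apply/hasP; exists g.+1; first by rewrite mem_iota; lia.
  rewrite /admissible [_.-1]/= g0 -lt0n g_pos; apply/hasP; exists g.+1.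
    by rewrite mem_iota; lia.
  rewrite /TA_cond ZL_diag //=; last by lia.
  have: psum q g = 0.
    elim: g {lt_gq g0 g_pos} g_min => [|g IHg] g_min; first by rewrite /psum take0.
    rewrite psumS IHg => [|i /g_min]; last by lia.
    by apply/eqP; rewrite -leqn0 leqNgt; apply/negP => /g_min; rewrite ltnn.
  by move->.
rewrite has_filter TA_last => ne.
have: last 0 [seq g <- iota 1 (size q) | admissible q S g]
        \in [seq g <- iota 1 (size q) | admissible q S g].
  by case: (filter _ _) ne => //= x s _; apply: mem_last.
rewrite mem_filter mem_iota => /andP[/andP[neq _] range].
split; first by lia.
rewrite ltn_neqAle eq_sym neq /=; apply: q_mono; lia.
Qed.

(** * Structured programs on the RAM *)

Inductive cmd : Type :=
| Block of seq instr
| Seq of cmd & cmd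
| If of nat & cmd & cmd
| While of nat & cmd.

Fixpoint csize (c : cmd) : nat :=
  match c with
  | Block l => size l
  | Seq a b => csize a + csize b
  | If _ a b => csize a + csize b + 2
  | While _ a => csize a + 2
  end.

(* [o] is the address of the first instruction; [If] and [While] read a nonzero
   register as true. *)
Fixpoint compile (o : nat) (c : cmd) : program :=
  match c with
  | Block l => l
  | Seq a b => compile o a ++ compile (o + csize a) b
  | If r a b =>
      IJz r (o + csize a + 2) :: compile o.+1 a ++
      IJmp (o + csize a + csize b + 2) :: compile (o + csize a + 2) b
  | While r a => IJz r (o + csize a + 2) :: compile o.+1 a ++ [:: IJmp o]
  end.

Lemma size_compile (c : cmd) (o : nat) : size (compile o c) = csize c.
Proof.
elim: c o => [l|a IHa b IHb|r a IHa b IHb|r a IHa] o //=;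
  by rewrite size_cat /= ?IHa ?IHb; lia.
Qed.

Definition placed (P : program) (o : nat) (l : program) : Prop :=
  forall j, j < size l -> nth IHalt P (o + j) = nth IHalt l j.

Lemma placed_cat (P : program) (o : nat) (l1 l2 : program) :
  placed P o (l1 ++ l2) -> placed P o l1 /\ placed P (o + size l1) l2.
Proof.
move=> Pl; split=> j lt_j.
  by rewrite Pl ?size_cat ?nth_cat ?lt_j //; lia.
rewrite -addnA Pl ?size_cat ?ltn_add2l // nth_cat.
by rewrite ltnNge leq_addr /= addKn.
Qed.

Lemma placed_cons (P : program) (o : nat) (i : instr) (l : program) :
  placed P o (i :: l) -> nth IHalt P o = i /\ placed P o.+1 l.
Proof.
move=> Pl; split=> [|j lt_j]; first by rewrite -[o in LHS]addn0 Pl.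
by rewrite addSnnS Pl.
Qed.

(** * A total-correctness logic with bounds on time, space and words *)

Section Logic.

Variables (inp : seq nat) (SB VB : nat).
(* Registers below 25 are the scalar variables of the program. *)
Hypothesis SB_ge : 25 <= SB.
Hypothesis inp_le : forall i, nth 0 inp i <= VB.

Local Notation assertion := ((nat -> nat) -> seq nat -> Prop).

(** Bounding every register, and not just [maxval], bounds the words that later loads, stores and
    subtractions write. *)
Definition reaches (P : program) (st : state) (tau pos : nat) (Q : assertion) : Prop :=
  exists t st', [/\ iter t (step P inp) st = st', t <= tau, pc st' = pos,
    [/\ space st' <= SB, maxval st' <= VB & forall r, regs st' r <= VB] &
    Q (regs st') (out st')].

(** A triple whose precondition is a concrete register file and output. Quantifying over the
    position of the code and the resources already used makes triples compose. *)
Definition achieves (c : cmd) (tau : nat) (R : nat -> nat) (o : seq nat)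
    (Q : assertion) : Prop :=
  forall P pos s v, placed P pos (compile pos c) ->
    s <= SB -> v <= VB -> (forall r, R r <= VB) ->
    reaches P (State pos R o s v) tau (pos + csize c) Q.

Lemma reaches_step (P : program) (st : state) (tau pos : nat) (Q : assertion) :
  reaches P (step P inp st) tau pos Q -> reaches P st tau.+1 pos Q.
Proof.
case=> t [st' [it le_t pc' bd Q']]; exists t.+1, st'; split=> //.
by rewrite iterSr.
Qed.

Lemma reaches_trans (P : program) (st : state) (tau1 tau2 pos1 pos2 : nat)
    (Q1 Q2 : assertion) :
  reaches P st tau1 pos1 Q1 ->
  (forall R o s v, Q1 R o -> s <= SB -> v <= VB -> (forall r, R r <= VB) ->
     reaches P (State pos1 R o s v) tau2 pos2 Q2) ->
  reaches P st (tau1 + tau2) pos2 Q2.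
Proof.
case=> t [[p R o s v] /= [it le_t eq_p [sb vb rb] Q']].
move: it; rewrite {p}eq_p => it /(_ _ _ _ _ Q' sb vb rb).
case=> t' [st' [it' le_t' pc' bd Q2']]; exists (t' + t), st'; split=> //.
  by rewrite iterD it.
by rewrite addnC leq_add.
Qed.

Lemma reaches_weaken (P : program) (st : state) (tau tau' pos pos' : nat)
    (Q Q' : assertion) :
  reaches P st tau pos Q -> pos = pos' -> tau <= tau' ->
  (forall R o, Q R o -> Q' R o) -> reaches P st tau' pos' Q'.
Proof.
case=> t [st' [it le_t pc' bd HQ]] <- le_tau QQ'; exists t, st'; split=> //.
  exact: leq_trans le_tau.
exact: QQ'.
Qed.

Lemma achieves_weaken (c : cmd) (tau tau' : nat) (R : nat -> nat) (o : seq nat)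
    (Q Q' : assertion) :
  achieves c tau R o Q -> tau <= tau' -> (forall R o, Q R o -> Q' R o) ->
  achieves c tau' R o Q'.
Proof.
move=> cQ le_tau QQ' P pos s v Pc sb vb rb.
exact: (reaches_weaken (cQ P pos s v Pc sb vb rb)).
Qed.

Lemma achieves_le (c : cmd) (tau tau' : nat) (R : nat -> nat) (o : seq nat)
    (Q : assertion) :
  tau <= tau' -> achieves c tau R o Q -> achieves c tau' R o Q.
Proof. by move=> le_tau cQ; apply: achieves_weaken cQ _ _. Qed.

Lemma achieves_seq (c1 c2 : cmd) (tau1 tau2 : nat) (R : nat -> nat)
    (o : seq nat) (Q1 Q : assertion) :
  achieves c1 tau1 R o Q1 ->
  (forall R' o', Q1 R' o' -> achieves c2 tau2 R' o' Q) ->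
  achieves (Seq c1 c2) (tau1 + tau2) R o Q.
Proof.
move=> c1Q c2Q P pos s v /= /placed_cat[]; rewrite size_compile => P1 P2 sb vb rb.
apply: reaches_trans (c1Q P pos s v P1 sb vb rb) _ => R' o' s' v' Q1' sb' vb' rb'.
by rewrite addnA; apply: c2Q.
Qed.

(** The extra 2 steps pay for the test and for the jump over [c2], which only the branch [c1]
    takes. *)
Lemma achieves_if (r : nat) (c1 c2 : cmd) (tau : nat) (R : nat -> nat)
    (o : seq nat) (Q : assertion) :
  r < 25 -> achieves (if R r == 0 then c2 else c1) tau R o Q ->
  achieves (If r c1 c2) (tau + 2) R o Q.
Proof.
move=> lt_r cQ P pos s v /= /placed_cons[Pjz /placed_cat[]].
rewrite size_compile => P1 /placed_cons[Pjmp P2] sb vb rb.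
rewrite addn2; apply: reaches_step; rewrite /step /= Pjz.
have sb' : maxn s r.+1 <= SB by rewrite geq_max sb (leq_trans _ SB_ge).
case: ifP cQ => _ cQ.
  have eq_pos : (pos.+1 + csize c1).+1 = pos + csize c1 + 2 by lia.
  rewrite eq_pos in P2.
  by apply: reaches_weaken (cQ _ _ _ _ P2 sb' vb rb) _ _ _ => //; lia.
rewrite -[tau.+1]addn1; apply: reaches_trans (cQ _ _ _ _ P1 sb' vb rb) _.
move=> R' o' s1 v1 Q' sb1 vb1 rb1; apply: reaches_step.
rewrite /step /= Pjmp; exists 0; eexists; split=> //=; lia.
Qed.

Lemma achieves_while_stop (r : nat) (c : cmd) (R : nat -> nat) (o : seq nat)
    (Q : assertion) :
  r < 25 -> R r = 0 -> Q R o -> achieves (While r c) 1 R o Q.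
Proof.
move=> lt_r Rr HQ P pos s v /= /placed_cons[Pjz _] sb vb rb.
apply: reaches_step; rewrite /step /= Pjz Rr /=.
exists 0; eexists; split=> //=; first by lia.
by split=> //; rewrite geq_max sb (leq_trans _ SB_ge).
Qed.

(** The extra 2 steps are the test and the jump back. *)
Lemma achieves_while_step (r : nat) (c : cmd) (tau1 tau2 : nat)
    (R : nat -> nat) (o : seq nat) (Q1 Q : assertion) :
  r < 25 -> 0 < R r -> achieves c tau1 R o Q1 ->
  (forall R' o', Q1 R' o' -> achieves (While r c) tau2 R' o' Q) ->
  achieves (While r c) (tau1 + tau2 + 2) R o Q.
Proof.
move=> lt_r; rewrite lt0n => /negPf Rr cQ wQ P pos s v Pw sb vb rb.
have /= /placed_cons[Pjz /placed_cat[]] := Pw.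
rewrite size_compile => Pc /placed_cons[Pjmp _].
rewrite addn2 -addnS; apply: reaches_step; rewrite /step /= Pjz Rr.
have sb' : maxn s r.+1 <= SB by rewrite geq_max sb (leq_trans _ SB_ge).
apply: reaches_trans (cQ _ _ _ _ Pc sb' vb rb) _.
move=> R' o' s1 v1 Q' sb1 vb1 rb1; apply: reaches_step.
by rewrite /step /= Pjmp; apply: wQ.
Qed.

(** Blocks are straight-line code on scalars; other memory is reached only by [ILoad] and [IStore].
    Literals stop at 25, so that [VB_ge] bounds them; 26 is built by an addition. *)
Definition scalar_instr (i : instr) : bool :=
  match i with
  | IConst d c => (d < 25) && (c <= 25)
  | IAdd d a b | ISub d a b => [&& d < 25, a < 25 & b < 25]
  | ILoad d a | IStore d a | IIn d a => (d < 25) && (a < 25)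
  | IOut s => s < 25
  | _ => false
  end.

(** Given [scalar_instr], only additions can break the word bound and only indirect accesses the
    space bound, so these alone carry side conditions. *)
Fixpoint block_wp (l : seq instr) (Q : assertion) (R : nat -> nat)
    (o : seq nat) : Prop :=
  if l is i :: l' then
    match i with
    | IConst d c => block_wp l' Q (upd R d c) o
    | IAdd d a b => R a + R b <= VB /\ block_wp l' Q (upd R d (R a + R b)) o
    | ISub d a b => block_wp l' Q (upd R d (R a - R b)) o
    | ILoad d a => R a < SB /\ block_wp l' Q (upd R d (R (R a))) o
    | IStore a s => R a < SB /\ block_wp l' Q (upd R (R a) (R s)) o
    | IIn d a => block_wp l' Q (upd R d (nth 0 inp (R a))) o
    | IOut s => block_wp l' Q R (rcons o (R s))
    | _ => False
    end
  else Q R o.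

Hypothesis VB_ge : 25 <= VB.

Lemma achieves_block (l : seq instr) (R : nat -> nat) (o : seq nat)
    (Q : assertion) :
  all scalar_instr l -> block_wp l Q R o -> achieves (Block l) (size l) R o Q.
Proof.
move=> l_ok l_wp P pos s v /=.
elim: l l_ok R o l_wp pos s v => [|i l IHl] /=.
  move=> _ R o HQ pos s v _ sb vb rb.
  by exists 0; eexists; split=> //=; rewrite ?addn0.
move=> /andP[i_ok l_ok] R o i_wp pos s v /placed_cons[Pi Pl] sb vb rb.
apply: reaches_step; rewrite /step /= Pi -addSnnS.
have updb d w : w <= VB -> forall r, upd R d w r <= VB.
  by move=> wb r; rewrite /upd; case: ifP.
case: i i_ok i_wp {Pi} => //= [d c|d a b|d a b|d a|d a|d a|a] i_ok i_wp;
  try case: i_wp => [cond i_wp]; apply: (IHl l_ok _ _ i_wp) => //;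
  rewrite ?geq_max ?vb ?sb ?updb ?inp_le ?andbT //=; try lia;
  try (by apply: updb; rewrite ?inp_le ?rb //; try lia; exact: leq_trans (leq_subr _ _) _).
all: try exact: leq_trans (leq_subr _ _) (rb _).
all: by apply: updb; exact: leq_trans (leq_subr _ _) (rb _).
Qed.

End Logic.

Lemma updE (f : nat -> nat) (d v i : nat) :
  upd f d v i = if i == d then v else f i.
Proof. by []. Qed.

Lemma achieves_block_seq (inp : seq nat) (SB VB : nat) (l : seq instr) (c : cmd)
    (tau : nat) (R : nat -> nat) (o : seq nat) Q :
  25 <= SB -> (forall i, nth 0 inp i <= VB) -> 25 <= VB -> all scalar_instr l ->
  block_wp inp SB VB l (fun R o => achieves inp SB VB c tau R o Q) R o ->
  achieves inp SB VB (Seq (Block l) c) (size l + tau) R o Q.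
Proof.
by move=> SB_ge inp_le VB_ge l_ok l_wp; apply: achieves_seq (achieves_block _ _ _ _ l_wp) _.
Qed.

Lemma achieves_while_block (inp : seq nat) (SB VB r : nat) (l : seq instr)
    (tau : nat) (R : nat -> nat) (o : seq nat) Q :
  25 <= SB -> (forall i, nth 0 inp i <= VB) -> 25 <= VB ->
  r < 25 -> all scalar_instr l -> 0 < R r ->
  block_wp inp SB VB l
    (fun R o => achieves inp SB VB (While r (Block l)) tau R o Q) R o ->
  achieves inp SB VB (While r (Block l)) (size l + tau + 2) R o Q.
Proof.
move=> SB_ge inp_le VB_ge lt_r l_ok Rr l_wp.
exact: achieves_while_step (achieves_block _ _ _ _ l_wp) _.
Qed.

(** * Rules for the symbolic execution of blocks *)

Section BlockSteps.

Variables (inp : seq nat) (SB VB : nat) (l : seq instr).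
Variables (R : nat -> nat) (o : seq nat) (Q : (nat -> nat) -> seq nat -> Prop).
Local Notation wp l R o := (block_wp inp SB VB l Q R o).

Lemma wp_const (d c : nat) : wp l (upd R d c) o -> wp (IConst d c :: l) R o.
Proof. by []. Qed.

(** Naming the result [x] lets [exec] simplify it by the known register equations before it is
    written; the rules below do the same. *)
Lemma wp_add (d a b x : nat) :
  R a + R b = x -> x <= VB -> wp l (upd R d x) o -> wp (IAdd d a b :: l) R o.
Proof. by move=> <-. Qed.

Lemma wp_sub (d a b x : nat) :
  R a - R b = x -> wp l (upd R d x) o -> wp (ISub d a b :: l) R o.
Proof. by move=> <-. Qed.

Lemma wp_load (d a p x : nat) :
  R a = p -> p < SB -> R p = x -> wp l (upd R d x) o -> wp (ILoad d a :: l) R o.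
Proof. by move=> <- ? <-. Qed.

Lemma wp_store (a s p x : nat) :
  R a = p -> p < SB -> R s = x -> wp l (upd R p x) o -> wp (IStore a s :: l) R o.
Proof. by move=> <- ? <-. Qed.

Lemma wp_in (d a p x : nat) :
  R a = p -> nth 0 inp p = x -> wp l (upd R d x) o -> wp (IIn d a :: l) R o.
Proof. by move=> <- <-. Qed.

Lemma wp_out (s x : nat) :
  R s = x -> wp l R (rcons o x) -> wp (IOut s :: l) R o.
Proof. by move=> <-. Qed.

End BlockSteps.

(** * The simulation program *)

Local Arguments mi : simpl never.
Local Arguments encode_input : simpl never.
Local Infix ";;" := Seq (at level 61, right associativity).

(* Registers 0-6 are fixed during a round, 7-13 while gamma is fixed; the others
   vary with h. *)
Local Notation rK := 0.
Local Notation rOne := 1.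
Local Notation rIn := 2.
Local Notation rT := 3.
Local Notation rP := 4.
Local Notation rN := 5.
Local Notation rS := 6.
Local Notation rG := 7.
Local Notation rA := 8.
Local Notation rDiff := 9.
Local Notation rPre := 10.
Local Notation rQG := 11.
Local Notation rGrem := 12.
Local Notation rB := 13.
Local Notation rX := 14.
Local Notation rZL := 15.
Local Notation rE := 16.
Local Notation rQH := 17.
Local Notation rHrem := 18.
Local Notation rCell := 19.
Local Notation rPos := 20.
Local Notation rCnt := 21.
Local Notation rD := 22.
Local Notation rV := 23.
Local Notation rCell1 := 24.

Definition advance : cmd :=
  While rD (Block [:: IAdd rV rIn rPos; IIn rV rV; IAdd rCnt rCnt rV;
                      IAdd rPos rPos rOne; ISub rD rD rOne]).

(* The final value of [rX] is the largest gamma passing a test, since rows are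
   visited in increasing order.  On the branch [rD = 0], adding [rD] is a move. *)
Definition visit_cell : cmd :=
  Block [:: ILoad rV rQH; IAdd rE rE rV; ILoad rPos rCell;
            IAdd rCell1 rCell rOne; ILoad rCnt rCell1; ISub rD rE rPos] ;;
  advance ;;
  Block [:: IStore rCell rPos; IStore rCell1 rCnt; ISub rD rCnt rP] ;;
  If rS (Block [:: IConst rD 0]) (Block [::]) ;;
  Block [:: ISub rD rZL rD] ;;
  If rD (Block [::]) (If rDiff (Block [:: IAdd rX rG rD]) (Block [::])) ;;
  Block [:: IAdd rZL rZL rA; IAdd rQH rQH rOne; IAdd rCell rCell rOne;
            IAdd rCell rCell rOne; ISub rHrem rHrem rOne].

(** [rE] starts at the window end for column [g.-1], and each cell adds its own quota to it. The
    final shift of [rCell] by [2 * g] skips the [g] pairs of the next row that lie left of its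
    diagonal. *)
Definition visit_row : cmd :=
  Block [:: ILoad rB rQG; ISub rDiff rB rA; IConst rD 0; IAdd rZL rPre rD;
            IAdd rE rT rPre; ISub rE rE rA; IAdd rQH rQG rD;
            IAdd rHrem rGrem rD] ;;
  While rHrem visit_cell ;;
  Block [:: IAdd rCell rCell rG; IAdd rCell rCell rG; IAdd rPre rPre rB;
            IConst rD 0; IAdd rA rB rD; IAdd rG rG rOne; IAdd rQG rQG rOne;
            ISub rGrem rGrem rOne].

Definition round : cmd :=
  Block [:: IAdd rV rIn rT; IIn rS rV; IConst rX 0; IConst rG 1; IConst rA 0;
            IConst rPre 0; IConst rQG 25; IAdd rQG rQG rOne;
            IAdd rCell rQG rK; ISub rGrem rK rPre] ;;
  While rGrem visit_row ;;
  Block [:: IOut rX; IConst rV 25; IAdd rV rV rX; ILoad rD rV;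
            ISub rD rD rOne; IStore rV rD; IAdd rP rP rS; IAdd rT rT rOne;
            ISub rN rN rOne].

Definition copy_quotas : cmd :=
  While rGrem
    (Block [:: IIn rD rV; IStore rQG rD; IAdd rV rV rOne; IAdd rQG rQG rOne;
               ISub rGrem rGrem rOne]).

Definition load_quotas : cmd :=
  Block [:: IIn rK rT; IConst rIn 2; IAdd rIn rIn rK; IConst rV 2;
            IConst rQG 25; IAdd rQG rQG rOne; ISub rGrem rK rT] ;;
  copy_quotas.

(** When [n = 0] the time allowed is a constant while [k] is arbitrary, so the program must stop
    before loading the quotas. *)
Definition main : cmd :=
  Block [:: IConst rOne 1; IIn rN rOne] ;;
  If rN (load_quotas ;; While rN round) (Block [::]).

(** * Input decoding, resource bounds and memory layout *)

Section Correctness.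

Variables (m : seq nat) (T : seq HL).

Local Notation k := (size m).
Local Notation n := (size T).
Local Notation inp := (encode_input m T).
(** 25 scalars, [k + 1] quotas counting q_0, and two registers for each of [k ^ 2] pairs. *)
Local Notation SB := (26 + k + 2 * k ^ 2).
Local Notation VB := (30 + n + 4 * k + 2 * k ^ 2).
Local Notation achieves := (achieves inp SB VB).
Local Notation letter := (nth 0 (map code T)).

Hypothesis size_T : n = sumn m.

Lemma SB_ge : 25 <= SB. Proof. lia. Qed.
Lemma VB_ge : 25 <= VB. Proof. lia. Qed.

Lemma letter_le1 (j : nat) : letter j <= 1.
Proof.
have [lt_jn|le_nj] := ltnP j n; last by rewrite nth_default ?size_map.
by rewrite (nth_map H) //; case: (nth _ _ _).
Qed.

Lemma countL_le (p : nat) : countL T p <= p.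
Proof.
elim: p => [|p IHp]; first by rewrite /countL take0.
by rewrite countLS; have := letter_le1 p; lia.
Qed.

Lemma inp_quota (i : nat) : i < k -> nth 0 inp (i + 2) = mi m i.+1.
Proof. by move=> lt_ik; rewrite addnC !addSn add0n /encode_input /= nth_cat lt_ik. Qed.

Lemma inp_letter (j : nat) : nth 0 inp (k + 2 + j) = letter j.
Proof. by rewrite (addnC k) -addnA !addSn add0n /= nth_cat ltnNge leq_addr addKn. Qed.

Lemma mi_le_n (i : nat) : mi m i <= n.
Proof.
rewrite size_T -[in sumn m](take_size m); have [le_ik|lt_ki] := leqP i k.
  exact: mi_le_psum.
by case: i lt_ki => // i lt_ki; rewrite /mi nth_default.
Qed.

Lemma inp_le (i : nat) : nth 0 inp i <= VB.
Proof.
rewrite /encode_input; case: i => [|[|i]] /=; try lia; rewrite nth_cat; case: ltnP => [lt_ik|_].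
  by have := mi_le_n i.+1; rewrite /mi; lia.
by have := letter_le1 (i - k); lia.
Qed.

Local Notation block := (achieves_block SB_ge inp_le VB_ge).
Local Notation block_seq := (achieves_block_seq SB_ge inp_le VB_ge).
Local Notation while_block := (achieves_while_block SB_ge inp_le VB_ge).
Local Notation cond := (achieves_if (inp := inp) (VB := VB) SB_ge).
Local Notation while_step := (achieves_while_step (inp := inp) (VB := VB) SB_ge).
Local Notation while_stop := (achieves_while_stop inp (VB := VB) SB_ge).

(* Register [25 + i] holds q_i, with q_0 = 0; the pair (g, h) owns the two
   registers at [addr g h]. *)
Definition addr (g h : nat) : nat := 26 + k + 2 * (g.-1 * k + h.-1).

Lemma addr_ge (g h : nat) : 26 + k <= addr g h.
Proof. exact: leq_addr. Qed.

Lemma addr_lt (g h : nat) : 0 < g <= k -> 0 < h <= k -> (addr g h).+1 < SB.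
Proof. case: g h => // g [] // h /andP[_ lt_gk] /andP[_ lt_hk].
have := leq_mul lt_gk (leqnn k); rewrite mulSn mulnn /addr /=; lia. Qed.

(** Since [h.-1 < k], Euclidean division by [k] recovers row and column. *)
Lemma addr_inj (g h g' h' : nat) : 0 < g -> 0 < g' -> 0 < h <= k -> 0 < h' <= k ->
  addr g h = addr g' h' -> g = g' /\ h = h'.
Proof.
case: g g' h h' => // g [] // g' [] // h [] // h'; rewrite /addr /= => _ _ hk hk'.
move=> eq_a; have eq_e : g * k + h = g' * k + h' by lia.
have := congr1 (divn^~ k) eq_e; rewrite !divnMDl; try lia.
rewrite !divn_small; lia.
Qed.

(** All cells start at addresses of one parity, so the count of one cell never overlaps the end
    stored in another. *)
Lemma addr_parity (g h g' h' : nat) : addr g h != (addr g' h').+1.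
Proof.
rewrite /addr; move: (g.-1 * k + h.-1) (g'.-1 * k + h'.-1) => a b; lia.
Qed.

Lemma addrS (g h : nat) : 0 < h -> addr g h.+1 = addr g h + 2.
Proof. case: h => // h _; rewrite /addr /=; lia. Qed.

Lemma addr_next_row (g : nat) : 0 < g -> addr g k.+1 + 2 * g = addr g.+1 g.+1.
Proof. case: g => // g _; rewrite /addr /= mulSn; lia. Qed.

Ltac resolve_ifs :=
  repeat match goal with
  | |- context [if ?a == ?b then _ else _] =>
      first [rewrite (_ : (a == b) = false); last by lia
            | rewrite (_ : (a == b) = true); last by lia]
  end.

Ltac read eqs := rewrite ?updE /=; resolve_ifs; rewrite ?eqs; reflexivity.

Ltac exec eqs :=
  lazymatch goal with
  | |- block_wp _ _ _ (IConst _ _ :: _) _ _ _ => apply: wp_const; exec eqs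
  | |- block_wp _ _ _ (IAdd _ _ _ :: _) _ _ _ =>
      eapply wp_add; [read eqs | try lia | exec eqs]
  | |- block_wp _ _ _ (ISub _ _ _ :: _) _ _ _ =>
      eapply wp_sub; [read eqs | exec eqs]
  | |- block_wp _ _ _ (ILoad _ _ :: _) _ _ _ =>
      eapply wp_load; [read eqs | try lia | read eqs | exec eqs]
  | |- block_wp _ _ _ (IStore _ _ :: _) _ _ _ =>
      eapply wp_store; [read eqs | try lia | read eqs | exec eqs]
  | |- block_wp _ _ _ (IIn _ _ :: _) _ _ _ =>
      eapply wp_in; [read eqs | read eqs | exec eqs]
  | |- block_wp _ _ _ (IOut _ :: _) _ _ _ =>
      eapply wp_out; [read eqs | exec eqs]
  | |- _ => cbn [block_wp]
  end.

Lemma advance_ok (R : nat -> nat) (o : seq nat) (d : nat) :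
  R rOne = 1 -> R rIn = k + 2 -> R rD = d -> R rPos + d <= n ->
  R rCnt = countL T (R rPos) ->
  achieves advance (7 * d + 1) R o (fun R' o' =>
    [/\ o' = o, R' rPos = R rPos + d, R' rCnt = countL T (R rPos + d) &
        forall r, r < 20 \/ 24 <= r -> R' r = R r]).
Proof.
elim: d R => [|d IHd] R R_one R_in R_d le_n R_cnt.
  by apply: while_stop; rewrite ?addn0.
rewrite (_ : 7 * d.+1 + 1 = 5 + (7 * d + 1) + 2); last by lia.
apply: while_block; rewrite ?R_d //.
exec (R_one, R_in, R_d, R_cnt, inp_letter).
  by have := countL_le (R rPos); have := letter_le1 (R rPos); lia.
apply: achieves_weaken (IHd _ _ _ _ _ _) _ _ => //.
all: rewrite ?updE /= ?addn1 ?subn1 //; try lia.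
  by rewrite countLS.
move=> R' o' [-> -> -> R'E]; split; rewrite ?addSn ?addnS //.
by move=> r r_out; rewrite R'E // !updE; resolve_ifs.
Qed.

(** * One round: register invariants, then a cell, a row and all rows *)

Section Round.

Variables (t : nat) (q : seq nat).
Hypotheses (t_lt : t < n) (size_q : size q = k) (q_mono : mono q).
Hypothesis sum_q : sumn q = n - t.

Lemma psum_q_le (h : nat) : psum q h <= n - t.
Proof.
rewrite -sum_q -[in sumn q](take_size q); have [|lt_qh] := leqP h (size q).
  exact: psum_le.
by rewrite /psum (take_oversize (ltnW lt_qh)) take_size.
Qed.

Lemma target_le (g h : nat) : target t q g h <= n.
Proof. by have := psum_q_le h; rewrite /target; lia. Qed.

Record round_regs (R : nat -> nat) : Prop := RoundRegs {
  K_eq : R rK = k; One_eq : R rOne = 1; In_eq : R rIn = k + 2; T_eq : R rT = t;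
  P_eq : R rP = countL T t; N_eq : R rN = n - t; S_eq : R rS = letter t;
  quota_eq : forall i, i <= k -> R (25 + i) = mi q i }.

Record row_regs (g : nat) (R : nat -> nat) : Prop := RowRegs {
  G_eq : R rG = g; A_eq : R rA = mi q g.-1; Diff_eq : R rDiff = mi q g - mi q g.-1;
  Pre_eq : R rPre = psum q g.-1; QG_eq : R rQG = 25 + g;
  Grem_eq : R rGrem = k.+1 - g; B_eq : R rB = mi q g }.

Record cell_regs (g h x : nat) (R : nat -> nat) : Prop := CellRegs {
  ZL_eq : R rZL = ZL q g h; E_eq : R rE = t + psum q h.-1 - mi q g.-1;
  QH_eq : R rQH = 25 + h; Hrem_eq : R rHrem = k.+1 - h;
  Cell_eq : R rCell = addr g h; X_eq : R rX = x }.

(* Cells are pairs (window end, number of Ls before it); the end lags behind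
   its target by at most [w], and not at all once the cell has been visited. *)
Definition cells (visited : nat -> nat -> bool) (w : nat) (R : nat -> nat) : Prop :=
  forall g h, 0 < g <= h -> h <= k ->
    R (addr g h).+1 = countL T (R (addr g h)) /\
    R (addr g h) <= target t q g h <= R (addr g h) + (if visited g h then 0 else w).

Definition before (g0 h0 g h : nat) : bool := (g < g0) || (g == g0) && (h < h0).

Lemma round_regs_keep (R R' : nat -> nat) : round_regs R ->
  (forall r, r < 7 \/ 25 <= r <= 25 + k -> R' r = R r) -> round_regs R'.
Proof.
clear t_lt size_q q_mono sum_q.
by case=> ? ? ? ? ? ? ? quota keep; split=> [|||||||i le_ik]; rewrite keep ?quota //; lia.
Qed.

Lemma row_regs_keep (g : nat) (R R' : nat -> nat) : row_regs g R ->
  (forall r, r < 14 -> R' r = R r) -> row_regs g R'.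
Proof. by case=> ? ? ? ? ? ? ? keep; split; rewrite keep. Qed.

(** Other cells keep their two registers by [addr_inj] and [addr_parity], and [before g h.+1]
    differs from [before g h] only at the pair just written. *)
Lemma cells_visit (g h w : nat) (R R' : nat -> nat) :
  0 < g <= h -> h <= k -> cells (before g h) w R ->
  R' (addr g h) = target t q g h -> R' (addr g h).+1 = countL T (target t q g h) ->
  (forall r, 26 + k <= r -> r <> addr g h -> r <> (addr g h).+1 -> R' r = R r) ->
  cells (before g h.+1) w R'.
Proof.
move=> gh hk cells_R pos' cnt' keep g' h' gh' hk'.
have [/andP[/eqP-> /eqP->]|ne] := boolP ((g' == g) && (h' == h)).
  by rewrite pos' cnt' leqnn leq_addr.
have ne_addr : addr g' h' <> addr g h by move=> /addr_inj; lia.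
have := addr_ge g' h'; have := addr_parity g' h' g h; have := addr_parity g h g' h'.
move=> par1 par2 ge; rewrite !keep; try lia.
have [-> bnd] := cells_R g' h' gh' hk'; split=> //.
rewrite (_ : before g h.+1 g' h' = before g h g' h') //.
by rewrite /before; lia.
Qed.

Lemma visit_cell_ok (g h x w : nat) (R : nat -> nat) (o : seq nat) :
  0 < g <= h -> h <= k -> round_regs R -> row_regs g R -> cell_regs g h x R ->
  cells (before g h) w R ->
  achieves visit_cell (24 + 7 * w) R o (fun R' o' =>
    [/\ o' = o, cells (before g h.+1) w R',
        cell_regs g h.+1 (if (mi q g != mi q g.-1) && TA_cond q (drop t T) g h
                          then g else x) R' &
        forall r, r < 14 \/ 25 <= r <= 25 + k -> R' r = R r]).
Proof.
move=> gh hk round_R row_R cell_R cells_R.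
have [pos_cnt /andP[pos_le pos_ge]] := cells_R g h gh hk.
rewrite /before ltnn eqxx ltnn /= in pos_ge.
have a_ge := addr_ge g h; have a_lt : (addr g h).+1 < SB by apply: addr_lt; lia.
(* The truncated subtraction is exact because [g.-1 <= h.-1]. *)
have E_step : t + psum q h.-1 - mi q g.-1 + mi q h = target t q g h.
  have := mi_le_psum q (i := g.-1) (h := h.-1).
  by rewrite /target -[in psum q h](@prednK h) ?psumS ?prednK; lia.
have tgt_le := target_le g h.
pose pos := R (addr g h); have pos_def : R (addr g h) = pos by [].
rewrite pos_def in pos_cnt pos_le pos_ge; clearbody pos.
rewrite -addn1 in pos_cnt.
have hq := quota_eq round_R hk.
(* In order: the loading block, [advance], the stores, the conditional on [rS], the comparison, the
   nested conditionals, the closing block. The lag bounds [target t q g h - pos] by [w]. *)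
apply: (achieves_le
  (tau := 6 + (7 * (target t q g h - pos) + 1 + (3 + (3 + (1 + (5 + 5))))))).
  by lia.
apply: block_seq => //.
have [K1 One1 In1 T1 P1 N1 S1 Q1] := round_R.
have [G1 A1 D1 Pre1 QG1 Gr1 B1] := row_R.
have [ZL1 E1 QH1 H1 C1 X1] := cell_R.
exec (One1, QH1, E1, C1, hq, E_step, pos_def, pos_cnt).
match goal with |- achieves _ _ ?S _ _ => set R1 := S end.
eapply achieves_seq; first apply: (@advance_ok R1 o (target t q g h - pos));
  rewrite /R1 ?updE //; first by rewrite /= subnKC.
rewrite /= subnKC // => R2 _ [-> pos2 cnt2 keep2'].
have cell1_2 : R2 rCell1 = addr g h + 1 by rewrite keep2' //; right.
have keep2 r : (r < 16) || (17 <= r < 20) || (25 <= r) -> R2 r = R r.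
  by move=> r_in; rewrite keep2' ?updE; resolve_ifs; lia.
have E2 : R2 rE = target t q g h by rewrite keep2' //; left.
apply: block_seq => //.
exec (pos2, cnt2, cell1_2, keep2 rCell isT, keep2 rP isT, C1, P1).
match goal with |- achieves _ _ ?S _ _ => set R3 := S end.
have keep3 r : (r < 16) || (17 <= r < 20) -> R3 r = R r.
  by move=> r_in; rewrite /R3 !updE; resolve_ifs; rewrite keep2 //; lia.
have E3 : R3 rE = target t q g h by rewrite /R3 !updE; resolve_ifs.
have D3 : R3 rD = countL T (target t q g h) - countL T t by [].
have pos3 : R3 (addr g h) = target t q g h by rewrite /R3 !updE; resolve_ifs.
have cnt3 : R3 (addr g h).+1 = countL T (target t q g h).
  by rewrite /R3 !updE; resolve_ifs.
have mem3 r : 25 <= r -> r <> addr g h -> r <> (addr g h).+1 -> R3 r = R r.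
  by move=> r_in ne ne1; rewrite /R3 !updE; resolve_ifs; rewrite keep2 //; lia.
clearbody R3; clear keep2' keep2 pos2 cnt2 cell1_2 E2 R2 R1.
pose gt := if letter t == 0 then countL T (target t q g h) - countL T t else 0.
apply: (achieves_seq (Q1 := fun R' o' =>
    [/\ o' = o, R' rD = gt & forall r, r != rD -> R' r = R3 r])).
  apply: (cond (tau := 1)) => //; rewrite (keep3 rS) // S1 /gt.
  case: ifP => _; last first.
    by apply: block => //; split=> // r /negPf ne; rewrite updE ne.
  by apply: (achieves_le (tau := 0)) => //; apply: block.
move=> R4 _ [-> D4 keep4]; apply: block_seq => //.
exec (D4, keep4 rZL isT, keep3 rZL isT, ZL1).
match goal with |- achieves _ _ ?S _ _ => set R5 := S end.
have {}keep4 r : r != rD -> R5 r = R3 r.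
  by move=> ne; rewrite -keep4 // /R5 updE (negPf ne).
have D5 : R5 rD = ZL q g h - gt by [].
clearbody R5; clear D4 R4.
set x' := if _ then g else x.
apply: (achieves_seq (Q1 := fun R' o' =>
    [/\ o' = o, R' rX = x' & forall r, r != rX -> R' r = R5 r])).
  apply: (cond (tau := 3)) => //.
  (* The truncated difference is 0 exactly when the count reaches [ZL]. *)
  have hitE : (R5 rD == 0) = TA_cond q (drop t T) g h.
    by rewrite D5 subn_eq0 TA_condE // size_q.
  rewrite hitE; case: ifP => hit; last first.
    apply: (achieves_le (tau := 0)) => //; apply: block => //.
    by split=> //; rewrite /x' hit andbF keep4 // keep3.
  apply: (cond (tau := 1)) => //.
  rewrite keep4 // keep3 // D1 subn_eq0.
  have -> : (mi q g <= mi q g.-1) = (mi q g == mi q g.-1).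
    by have := @q_mono g.-1 g; rewrite size_q; lia.
  case: eqP => eq_q; first apply: (achieves_le (tau := 0)) => //.
    by apply: block => //; split=> //; rewrite /x' eq_q eqxx keep4 // keep3.
  have /eqP D0 : R5 rD == 0 by rewrite hitE.
  apply: block => //; exec (keep4 rG isT, keep3 rG isT, G1, D0).
  split=> // [|r /negPf ne]; rewrite updE ?ne //= addn0 /x' hit andbT.
  by case: eqP eq_q.
move=> R6 _ [-> X6 keep6].
have {}keep6 r : r != rD -> r != rX -> R6 r = R3 r.
  by move=> neD neX; rewrite keep6 ?keep4.
have ZL6 : R6 rZL = ZL q g h by rewrite keep6 // keep3.
have ZL_step : ZL q g h + mi q g.-1 = ZL q g h.+1 by rewrite ZLS // size_q.
(* This is the word bound for the update of [rZL]: the new value is at most [ZL + ZH + mi q g.-1] at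
   [h], that is [psum q h]. *)
have ZL_le : ZL q g h.+1 <= n.
  have := window_size q_mono gh; rewrite size_q -ZL_step => /(_ hk).
  by have := psum_q_le h; lia.
apply: block => //.
exec (ZL6, ZL_step, keep6 rA isT isT, keep6 rOne isT isT, keep6 rQH isT isT,
  keep6 rCell isT isT, keep6 rHrem isT isT, keep3 rA isT, keep3 rOne isT,
  keep3 rQH isT, keep3 rCell isT, keep3 rHrem isT, A1, One1, QH1, C1, H1);
  try (rewrite ?ZL_step; lia).
match goal with |- context [cells _ _ ?S] => set R7 := S end.
split=> // [||r r_in].
- apply: (cells_visit gh hk cells_R) => [||r r_in ne ne1];
    rewrite /R7 !updE; resolve_ifs; rewrite keep6 //; try (apply/eqP; lia).
  by apply: mem3 => //; lia.
- split; rewrite /R7 ?updE /= ?X6 ?keep6 ?addrS //; lia.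
- rewrite /R7 !updE; resolve_ifs; rewrite keep6; try (apply/eqP; lia).
  by case: r_in => r_in; [rewrite keep3 //; lia | rewrite mem3 //; lia].
Qed.

(** [j] columns remain, and [x] is the answer from earlier rows. The scan goes on after a success,
    since every cell must reach its target in every round for its lag to stay bounded by 1. *)
Lemma visit_cells_ok (g h j x w : nat) (R : nat -> nat) (o : seq nat) :
  0 < g <= h -> h + j = k.+1 -> round_regs R -> row_regs g R ->
  cell_regs g h (if (mi q g != mi q g.-1) &&
      has (TA_cond q (drop t T) g) (iota g (h - g)) then g else x) R ->
  cells (before g h) w R ->
  achieves (While rHrem visit_cell) (j * (26 + 7 * w) + 1) R o (fun R' o' =>
    [/\ o' = o, cells (before g k.+1) w R',
        cell_regs g k.+1 (if admissible q (drop t T) g then g else x) R' &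
        forall r, r < 14 \/ 25 <= r <= 25 + k -> R' r = R r]).
Proof.
elim: j h R => [|j IHj] h R gh hj round_R row_R cell_R cells_R.
  have hk : h = k.+1 by lia.
  apply: while_stop => //; first by rewrite (Hrem_eq cell_R) hk subnn.
  by rewrite /admissible size_q -hk.
rewrite (_ : _ + 1 = 24 + 7 * w + (j * (26 + 7 * w) + 1) + 2); last by rewrite mulSn; lia.
apply: while_step => //; first by rewrite (Hrem_eq cell_R); lia.
  by apply: (visit_cell_ok _ gh _ round_R row_R cell_R cells_R); lia.
move=> R1 _ [-> cells1 cell1 keep1].
have round1 : round_regs R1.
  by apply: round_regs_keep round_R _ => r r_in; apply: keep1; lia.
have row1 : row_regs g R1.
  by apply: row_regs_keep row_R _ => r r_in; apply: keep1; lia.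
apply: achieves_weaken (IHj h.+1 R1 _ _ round1 row1 _ cells1) _ _ => //; try lia.
  rewrite subSn; last by lia.
  rewrite -[(h - g).+1]addn1 iotaD has_cat /= orbF subnKC; last by lia.
  by move: cell1; case: (mi q g != _) (has _ _) (TA_cond _ _ _ _) => [] [] [].
move=> R2 o2 [-> cells2 cell2 keep2]; split=> // r r_in.
by rewrite keep2 ?keep1.
Qed.

Record row_head (g x : nat) (R : nat -> nat) : Prop := RowHead {
  headG : R rG = g; headA : R rA = mi q g.-1; headPre : R rPre = psum q g.-1;
  headQG : R rQG = 25 + g; headGrem : R rGrem = k.+1 - g;
  headCell : R rCell = addr g g; headX : R rX = x }.

Lemma visit_row_ok (g x w : nat) (R : nat -> nat) (o : seq nat) :
  0 < g <= k -> round_regs R -> row_head g x R -> cells (before g g) w R ->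
  achieves visit_row (17 + k * (26 + 7 * w)) R o (fun R' o' =>
    [/\ o' = o, cells (before g.+1 g.+1) w R',
        row_head g.+1 (if admissible q (drop t T) g then g else x) R' &
        forall r, r < 7 \/ 25 <= r <= 25 + k -> R' r = R r]).
Proof.
move=> gk round_R head_R cells_R.
apply: (achieves_le (tau := 8 + ((k.+1 - g) * (26 + 7 * w) + 1 + 8))).
  have : (k.+1 - g) * (26 + 7 * w) <= k * (26 + 7 * w) by rewrite leq_mul2r; lia.
  by lia.
have [K1 One1 In1 T1 P1 N1 S1 Q1] := round_R.
have [G1 A1 Pre1 QG1 Gr1 C1 X1] := head_R.
have qg : R (25 + g) = mi q g by apply: Q1; lia.
have pre_le := psum_q_le g.-1.
apply: block_seq => //.
exec (One1, QG1, A1, Pre1, T1, Gr1, qg, addn0); try (rewrite ?addn0; lia).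
match goal with |- achieves _ _ ?S _ _ => set R1 := S end.
have keep1 r : r < 7 \/ 25 <= r -> R1 r = R r.
  by move=> r_in; rewrite /R1 !updE; resolve_ifs.
have round1 : round_regs R1.
  by apply: round_regs_keep round_R _ => r r_in; apply: keep1; lia.
have row1 : row_regs g R1 by split.
have cell1 : cell_regs g g (if (mi q g != mi q g.-1) &&
    has (TA_cond q (drop t T) g) (iota g (g - g)) then g else x) R1.
  rewrite subnn andbF; split=> //.
  by rewrite ZL_diag // size_q; lia.
have cells1 : cells (before g g) w R1.
  by move=> g' h' gh' hk'; have := addr_ge g' h' => ge; rewrite !keep1; try lia; apply: cells_R.
apply: (achieves_seq (visit_cells_ok (j := k.+1 - g) _ _ _ round1 row1 cell1 cells1)).
- by lia.
- by lia.
move=> R2 _ [-> cells2 cell2 keep2].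
have [G2 A2 _ Pre2 QG2 Gr2 B2] : row_regs g R2.
  by apply: row_regs_keep row1 _ => r r_in; apply: keep2; lia.
have [_ _ _ _ C2 X2] := cell2.
have One2 : R2 rOne = 1 by rewrite keep2 ?keep1 //; left.
have pre_step : psum q g.-1 + mi q g = psum q g.
  by have := psumS q g.-1; rewrite prednK; lia.
have pre_le' := psum_q_le g.
have next : addr g k.+1 + g + g = addr g.+1 g.+1.
  by rewrite -addr_next_row; lia.
(* After the last row this address exceeds [SB]; it is only held in [rCell] and not dereferenced, so
   the word bound suffices. *)
have next_le : addr g.+1 g.+1 <= VB.
  have : g * k <= k * k by rewrite leq_mul2r; lia.
  by rewrite /addr /= mulnn; lia.
apply: block => //.
exec (C2, G2, Pre2, B2, A2, One2, QG2, Gr2, addn0, pre_step, next);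
  try (rewrite ?addn0 ?next ?pre_step; lia).
match goal with |- context [cells _ _ ?S] => set R3 := S end.
have keep3 r : r < 7 \/ 25 <= r -> R3 r = R2 r.
  by move=> r_in; rewrite /R3 !updE; resolve_ifs.
split=> // [g' h' gh' hk'||r r_in].
- have ge := addr_ge g' h'; rewrite !keep3; try lia.
  have [-> bnd] := cells2 g' h' gh' hk'; split=> //.
  (* On pairs with [g' <= h' <= k], being past row [g] and being at the diagonal of row [g.+1] mean
     the same. *)
  rewrite (_ : before _ _ _ _ = before g k.+1 g' h') //.
  by rewrite /before; lia.
- by split; rewrite /R3 ?updE //=; lia.
- by rewrite keep3 ?keep2 ?keep1; lia.
Qed.

Lemma visit_rows_ok (g j w : nat) (R : nat -> nat) (o : seq nat) :
  0 < g -> g + j = k.+1 -> round_regs R ->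
  row_head g (last 0 [seq i <- iota 1 g.-1 | admissible q (drop t T) i]) R ->
  cells (before g g) w R ->
  achieves (While rGrem visit_row) (j * (19 + k * (26 + 7 * w)) + 1) R o
    (fun R' o' =>
    [/\ o' = o, cells (before k.+1 k.+1) w R', R' rX = TA q (drop t T) &
        forall r, r < 7 \/ 25 <= r <= 25 + k -> R' r = R r]).
Proof.
elim: j g R => [|j IHj] g R g_gt0 gj round_R head_R cells_R.
  have gk : g = k.+1 by lia.
  apply: while_stop => //; first by rewrite (headGrem head_R) gk subnn.
  by split=> //; rewrite -?gk // (headX head_R) TA_last size_q gk.
rewrite (_ : _ + 1 = 17 + k * (26 + 7 * w) + (j * (19 + k * (26 + 7 * w)) + 1) + 2);
  last by rewrite mulSn; lia.
apply: while_step => //; first by rewrite (headGrem head_R); lia.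
  by apply: (visit_row_ok _ _ round_R head_R cells_R); lia.
move=> R1 _ [-> cells1 head1 keep1].
have round1 := round_regs_keep round_R keep1.
apply: achieves_weaken (IHj g.+1 R1 _ _ round1 _ cells1) _ _ => //; try lia.
  have -> : iota 1 g.+1.-1 = iota 1 g.-1 ++ [:: g].
    by case: (g) g_gt0 => // g' _; have := iotaD 1 g' 1; rewrite addn1 add1n.
  by move: head1; rewrite filter_cat last_cat /=; case: admissible.
move=> R2 o2 [-> cells2 X2 keep2]; split=> // r r_in.
by rewrite keep2 ?keep1.
Qed.

End Round.

(** * The loop over rounds *)

Record loop_regs (t : nat) (q : seq nat) (R : nat -> nat) : Prop := LoopRegs {
  loopK : R rK = k; loopOne : R rOne = 1; loopIn : R rIn = k + 2;
  loopT : R rT = t; loopP : R rP = countL T t; loopN : R rN = n - t;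
  loop_quota : forall i, i <= k -> R (25 + i) = mi q i }.

(** The argument bounds the lag of the cells on entry: [n] in the first round, 1 in the others. *)
Definition round_time (w : nat) : nat := 20 + k * (19 + k * (26 + 7 * w)).

(** Whatever the lag on entry, all cells reach their targets during the round; by [target_decr]
    serving [x] then moves each target by at most 1, which is the lag on exit. *)
Lemma round_ok (t : nat) (q : seq nat) (w : nat) (R : nat -> nat) (o : seq nat) :
  t < n -> size q = k -> mono q -> sumn q = n - t -> 0 < k ->
  loop_regs t q R -> cells t q (fun _ _ => false) w R ->
  let x := TA q (drop t T) in
  achieves round (round_time w) R o (fun R' o' =>
    [/\ o' = rcons o x, loop_regs t.+1 (decr q x) R' &
        cells t.+1 (decr q x) (fun _ _ => false) 1 R']).
Proof.
move=> t_lt size_q q_mono sum_q k_gt0 loop_R cells_R x.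
have [] : 0 < x <= size q /\ mi q x.-1 < mi q x by apply: TA_valid => //; lia.
rewrite size_q => x_range x_step.
have [K0 One0 In0 T0 P0 N0 Q0] := loop_R.
apply: (achieves_le (tau := 10 + (k * (19 + k * (26 + 7 * w)) + 1 + 9))).
  by rewrite /round_time; lia.
apply: block_seq => //.
exec (K0, One0, In0, T0, inp_letter); try lia.
match goal with |- achieves _ _ ?S _ _ => set R1 := S end.
have keep1 r : r < 6 \/ 25 <= r -> R1 r = R r.
  by move=> r_in; rewrite /R1 !updE; resolve_ifs.
have round1 : round_regs t q R1.
  by split=> // i le_ik; rewrite keep1 ?Q0 //; lia.
have head1 : row_head q 1
    (last 0 [seq i <- iota 1 1.-1 | admissible q (drop t T) i]) R1.
  by split; rewrite /R1 ?updE //= /addr /psum ?take0 //; lia.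
have cells1 : cells t q (before 1 1) w R1.
  move=> g h gh hk; have ge := addr_ge g h; rewrite !keep1; try lia.
  have [-> bnd] := cells_R g h gh hk; split=> //.
  by rewrite (_ : before 1 1 g h = false) // /before; lia.
apply: (achieves_seq (visit_rows_ok t_lt size_q q_mono sum_q _ _ _ round1 head1 cells1)).
- by [].
- by lia.
move=> R2 _ [-> cells2 X2 keep2]; rewrite -/x in X2.
have [K2 One2 In2 T2 P2 N2 S2 Q2] := round_regs_keep round1 keep2.
have qx : R2 (25 + x) = mi q x by apply: Q2; lia.
have letter_step := esym (countLS T t).
apply: block => //.
exec (One2, T2, P2, N2, S2, X2, qx, letter_step); try lia.
  by have := countL_le t.+1; lia.
match goal with |- context [cells _ _ _ _ ?S] => set R3 := S end.
split=> [//||g h gh hk].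
  split; rewrite /R3 ?updE /= ?addn1 ?subn1 ?subnS //.
  move=> i le_ik; rewrite !updE mi_decr; resolve_ifs; rewrite eqn_add2l.
  by case: eqP => [->|_]; rewrite ?Q2 ?subn0 ?subn1.
have ge := addr_ge g h.
have mem3 r : 26 + k <= r -> R3 r = R2 r.
  by move=> r_in; rewrite /R3 !updE; resolve_ifs.
rewrite !mem3; try lia.
have [-> /andP[]] := cells2 g h gh hk.
have -> : before k.+1 k.+1 g h by rewrite /before; lia.
rewrite addn0 => le1 le2; split=> //.
have := @target_decr t q x g h; rewrite size_q => /(_ x_range x_step gh).
by lia.
Qed.

Lemma rounds_ok (j t : nat) (q : seq nat) (R : nat -> nat) (o : seq nat) :
  t + j = n -> size q = k -> mono q -> sumn q = n - t -> 0 < k ->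
  loop_regs t q R -> cells t q (fun _ _ => false) 1 R ->
  achieves (While rN round) (j * (round_time 1 + 2) + 1) R o
    (fun _ o' => o' = o ++ alg1_aux q (drop t T)).
Proof.
elim: j t q R o => [|j IHj] t q R o tj size_q q_mono sum_q k_gt0 loop_R cells_R.
  apply: while_stop => //; first by rewrite (loopN loop_R); lia.
  by rewrite drop_oversize ?cats0 //; lia.
have t_lt : t < n by lia.
rewrite (_ : _ + 1 = round_time 1 + (j * (round_time 1 + 2) + 1) + 2);
  last by rewrite mulSn; lia.
apply: while_step => //; first by rewrite (loopN loop_R); lia.
  exact: round_ok cells_R.
move=> R1 _ [-> loop1 cells1].
have [] : 0 < TA q (drop t T) <= size q /\
    mi q (TA q (drop t T)).-1 < mi q (TA q (drop t T)).
  by apply: TA_valid => //; lia.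
move=> x_range x_step.
apply: achieves_weaken (IHj _ _ _ _ _ _ _ _ _ loop1 cells1) _ _ => //.
- by lia.
- by rewrite size_decr.
- exact: mono_decr.
- by rewrite sumn_decr //; lia.
- by move=> _ o' ->; rewrite (drop_nth H t_lt) /= cat_rcons -drop_nth.
Qed.

(** * Initialisation and the whole program *)

Lemma copy_quotas_ok (j i : nat) (R : nat -> nat) (o : seq nat) :
  i + j = k -> R rOne = 1 -> R rV = i + 2 -> R rQG = 26 + i -> R rGrem = j ->
  (forall l, l <= i -> R (25 + l) = mi m l) ->
  achieves copy_quotas (7 * j + 1) R o (fun R' o' =>
    [/\ o' = o, forall l, l <= k -> R' (25 + l) = mi m l &
        forall r, r < 11 \/ 26 + k <= r -> R' r = R r]).
Proof.
elim: j i R => [|j IHj] i R ij R_one R_V R_QG R_rem R_quota.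
  by apply: while_stop => //; split=> // l le_lk; apply: R_quota; lia.
rewrite (_ : 7 * j.+1 + 1 = 5 + (7 * j + 1) + 2); last by lia.
have lt_ik : i < k by lia.
have i_le : i <= k := ltnW lt_ik.
apply: while_block => //; first by rewrite R_rem.
exec (R_one, R_V, R_QG, R_rem, inp_quota lt_ik).
apply: achieves_weaken (IHj i.+1 _ _ _ _ _ _ _) _ _ => //;
  rewrite ?updE; resolve_ifs => //; try lia.
  move=> l le_l; rewrite !updE; resolve_ifs; rewrite -[26 + i](addnS 25 i) eqn_add2l.
  by case: eqP => [->|ne] //; apply: R_quota; lia.
move=> R' o' [-> quota keep]; split=> // r r_in.
by rewrite keep // !updE; resolve_ifs.
Qed.

Lemma load_quotas_ok (R : nat -> nat) (o : seq nat) :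
  R rOne = 1 -> R rN = n -> (forall r, (r != rOne) && (r != rN) -> R r = 0) ->
  achieves load_quotas (7 * k + 8) R o (fun R' o' =>
    [/\ o' = o, loop_regs 0 m R' & forall r, 26 + k <= r -> R' r = 0]).
Proof.
move=> R_one R_n R_0.
rewrite (_ : 7 * k + 8 = 7 + (7 * k + 1)); last by lia.
apply: block_seq => //.
exec (R_one, R_0 rT isT, subn0, addnC 2 k).
match goal with |- achieves _ _ ?S _ _ => set R1 := S end.
apply: achieves_weaken (copy_quotas_ok (i := 0) o _ _ _ _ _ _) _ _ => //.
  by case=> // _; rewrite /R1 !updE /= R_0.
move=> R2 _ [-> quota keep]; split=> // [|r r_in].
  split=> //; rewrite keep; try lia; rewrite /R1 !updE /= ?subn0 ?R_one ?R_n ?R_0 //.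
  by rewrite /countL take0.
rewrite keep; last by right.
by rewrite /R1 !updE; resolve_ifs; rewrite R_0 //; lia.
Qed.

(** Initial block, loading, first round with lag [n], the other [n.-1] rounds with lag 1, and the
    outer tests and jumps. *)
Definition total_time : nat :=
  2 + (7 * k + 8 + (round_time n + (n.-1 * (round_time 1 + 2) + 1) + 2) + 2).

Lemma main_ok (R : nat -> nat) : sorted leq m -> (forall r, R r = 0) ->
  achieves main (if n == 0 then 4 else total_time) R [::]
    (fun _ o' => o' = algorithm1 m T).
Proof.
move=> /sorted_mono m_mono R_0; rewrite /main.
have inp1 : nth 0 inp 1 = n by [].
have [n0|n_gt0] := posnP n.
  apply: (achieves_le (tau := 2 + (0 + 2))) => //; apply: block_seq => //.
  exec (R_0, inp1); apply: cond => //.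
  rewrite updE /=; case: eqP n0 => // n0 _; apply: block => //=.
  by rewrite /algorithm1; case: (T) n0.
apply: block_seq => //.
exec (R_0, inp1).
match goal with |- achieves _ _ ?S _ _ => set R1 := S end.
apply: cond => //; rewrite (_ : R1 rN = n) //; case: eqP => [|_]; first by lia.
have k_gt0 : 0 < k by case: (m) size_T n_gt0 => // ->.
have R1_0 r : (r != rOne) && (r != rN) -> R1 r = 0.
  by move=> /andP[/negPf ne1 /negPf neN]; rewrite /R1 !updE ne1 neN.
apply: (achieves_seq (load_quotas_ok _ _ _ R1_0)) => // R2 _ [-> loop2 R2_0].
apply: while_step => //; first by rewrite (loopN loop2); lia.
  apply: round_ok loop2 _ => //; first by lia.
  (* Zeroed cells correctly describe the empty prefix, and their lag is the target itself, at most
     [n]. *)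
  move=> g h gh hk; have ge := addr_ge g h; rewrite !R2_0; try lia.
  by rewrite /countL take0 add0n; split=> //; apply: target_le; lia.
rewrite drop0 => R3 _ [-> loop3 cells3].
have [] : 0 < TA m T <= k /\ mi m (TA m T).-1 < mi m (TA m T).
  by apply: TA_valid => //; lia.
move=> x_range x_step.
apply: achieves_weaken (rounds_ok (j := n.-1) _ _ _ _ _ _ loop3 cells3) _ _ => //.
- by lia.
- by rewrite size_decr.
- exact: mono_decr.
- by rewrite sumn_decr //; lia.
- by move=> _ o' ->; rewrite /algorithm1; case: (T) n_gt0 => //= a l _; rewrite drop0.
Qed.

End Correctness.

Lemma total_time_le (m : seq nat) (T : seq HL) : 0 < size m -> 0 < size T ->
  total_time m T <= 200 * (size T * size m ^ 2).
Proof.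
move=> k_gt0 n_gt0; rewrite /total_time /round_time.
move: (size m) (size T) k_gt0 n_gt0 => k n k_gt0 n_gt0.
have -> : k * (19 + k * (26 + 7 * n)) = 19 * k + 26 * k ^ 2 + 7 * (n * k ^ 2).
  by rewrite -mulnn; ring.
have -> : k * (19 + k * (26 + 7 * 1)) = 19 * k + 33 * k ^ 2.
  by rewrite -mulnn; ring.
have k_le : k <= k ^ 2 by rewrite -mulnn leq_pmulr.
have le_nk : n + k ^ 2 <= (n * k ^ 2).+1.
  have : 0 < k ^ 2 by lia.
  by case: n (k ^ 2) n_gt0 => // n [] // s _ _; rewrite mulSn mulnS; lia.
(* 74 = 22 + 19 + 33, after bounding 1 and [k] by [k ^ 2]. *)
have nk2_le : n.-1 * (20 + (19 * k + 33 * k ^ 2) + 2) <= 74 * (n * k ^ 2) - 74 * k ^ 2.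
  rewrite -mulnBr -{3}[k ^ 2]mul1n -mulnBl subn1 mulnCA leq_mul2l; lia.
have : k ^ 2 <= n * k ^ 2 by rewrite leq_pmull.
by lia.
Qed.

(* There is a RAM program P and a constant c such that on every valid input
   (0 <= m_1 <= ... <= m_k, T_1..T_n in {H,L}, n = sum m_r), P halts within
   c*(n*k^2)+c steps with output exactly Algorithm 1's decision sequence,
   using at most c*k^2+c working registers holding words of value at most
   (n+k+2)^c. *)
Theorem theorem1 :
  exists (P : program) (c : nat),
    forall (m : seq nat) (T : seq HL),
      sorted leq m -> size T = sumn m ->
      exists t : nat,
        [/\ t <= c * (size T * (size m) ^ 2) + c,
            halted P (run P (encode_input m T) t),
            out (run P (encode_input m T) t) = algorithm1 m T,
            space (run P (encode_input m T) t) <= c * (size m) ^ 2 + c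
          & maxval (run P (encode_input m T) t) <= (size T + size m + 2) ^ c].
Proof.
exists (compile 0 main), 200 => m T m_sorted size_T.
have := @main_ok m T size_T (fun _ => 0) m_sorted (fun _ => erefl).
move=> /(_ (compile 0 main) 0 0 0) [] // t [st [run_t t_le pc_st [sp_le mv_le _] out_st]].
exists t; rewrite /run run_t; split=> //.
- apply: leq_trans t_le _; case: eqP => [|/eqP]; first by lia.
  rewrite -lt0n => n_gt0; apply: leq_trans (leq_addr _ _).
  by apply: total_time_le => //; case: (m) size_T n_gt0 => // ->.
(* Execution ends just past the code, where the default instruction is [IHalt]. *)
- by rewrite /halted pc_st nth_default // size_compile.
- have : size m <= size m ^ 2 by case: (size m) => // k; rewrite -mulnn leq_pmulr.
  by move=> k_le; apply: leq_trans sp_le _; lia.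
- apply: leq_trans mv_le _; move: (size T) (size m) => n k.
  (* Exponent 8 suffices: the word bound is at most [64 * (n + k + 2) ^ 2], and 64 is at most the
     sixth power of a base that is at least 2. *)
  have le8 : (n + k + 2) ^ 8 <= (n + k + 2) ^ 200 by rewrite leq_pexp2l //; lia.
  apply: leq_trans le8; rewrite (expnD _ 2 6).
  have le64 : 2 ^ 6 <= (n + k + 2) ^ 6 by rewrite leq_exp2r //; lia.
  apply: leq_trans (leq_mul (leqnn _) le64); rewrite -!mulnn; nia.
Qed.
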